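(* (Interactive Realizability Theorem.) Let $A$ be a formula of $\mathcal{L}_1$ with free variables among $\vec{x}=x_1,\ldots,x_k$, and suppose $\mathbf{PRA}+\mathbf{EM}_1\vdash A$. Then for every vector $\vec{\alpha}=\alpha_1,\ldots,\alpha_k$ of individuals in $\mathcal{S}\mathbb{N}$ there exists an interactive realizer $r(\vec{\alpha})$, recursive in $\vec{\alpha}$, such that $r(\vec{\alpha})\Vdash \vec{\alpha}:A$.
   Context: $\mathcal{L}_0$ is the quantifier-free language of primitive recursive arithmetic: individual variables, the constant $0$, the unary symbol $\mathsf{succ}$, a function symbol for each primitive recursive function, a predicate symbol (of fixed arity) for each syntactic definition of a primitive recursive predicate (including equality $=$), and connectives $\neg,\wedge,\vee,\rightarrow$. $\mathcal{L}_1$ extends $\mathcal{L}_0$ by adding, for each $(k+1)$-ary predicate symbol $P$ of $\mathcal{L}_0$, a new $k$-ary function symbol $\varphi_P$ and a new $k$-ary predicate symbol $\chi_P$. The theory $\mathbf{PRA}+\mathbf{EM}_1$ in $\mathcal{L}_1$ has as logical axioms those of intuitionistic predicate calculus with equality, as non-logical axioms the defining equations of all primitive recursive functions, $\neg\,\mathsf{succ}(0)=0$, and all instances of $(\chi)$: $P(\vec{x},y)\rightarrow\chi_P(\vec{x})$ and $(\varphi)$: $\chi_P(\vec{x})\rightarrow P(\vec{x},\varphi_P(\vec{x}))$; its rules are modus ponens, substitution (from $A(x)$ infer $A(t)$, provided $A(x)$ was derived from hypotheses not containing $x$), and induction (from $A(0)$ and $A(x)\rightarrow A(\mathsf{succ}(x))$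 infer $A(y)$). A state is a finite set $s$ of triples $\langle P,\vec{m},n\rangle$ with $P$ a $(k+1)$-ary predicate symbol of $\mathcal{L}_0$, $\vec{m}\in\mathbb{N}^k$, $n\in\mathbb{N}$, such that $P(\vec{m},n)$ is true in the standard model and, if $\langle P,\vec{m},n\rangle,\langle P,\vec{m},n'\rangle\in s$ (same predicate symbol, i.e. same syntactic definition), then $n=n'$. $\mathbb{S}$ is the set of states, ordered by inclusion $\sqsubseteq$, with bottom $\bot=\emptyset$; $s,s'$ are compatible if $s\cup s'\in\mathbb{S}$. For a set $X$, $\mathcal{S}X$ is the set of functions $\mathbb{S}\to X$. Define $[\![\chi_P]\!](\vec{m},s)=\mathsf{true}$ iff $\langle P,\vec{m},n\rangle\in s$ for some $n$, and $[\![\varphi_P]\!](\vec{m},s)=n$ if $\langle P,\vec{m},n\rangle\in s$, $=0$ otherwise. For an environment $\xi$ from variables to $\mathcal{S}\mathbb{N}$, terms and formulas are interpreted in $\mathcal{S}\mathbb{N}$, resp. $\mathcal{S}\mathrm{Bool}$: $[\![x]\!]_\xi=\xi(x)$, $[\![0]\!]_\xi=\lambda s.0$, $[\![f(t_1,\ldots,t_k)]\!]_\xi(s)=f([\![t_1]\!]_\xi(s),\ldots,[\![t_k]\!]_\xi(s))$ with $f$ the standard meaning, $[\![\varphi_P(\vec t)]\!]_\xi(s)=[\![\varphi_P]\!]([\![\vec t]\!]_\xi(s),s)$; atomic formulas $Q(\vec t)$ and $\chi_P(\vec t)$ analogously (standard meaning of $Q$ at the values at $s$, resp. $[\![\chi_P]\!]([\![\vec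 t]\!]_\xi(s),s)$); connectives are interpreted pointwise by the boolean operations. A weakly increasing sequence is $\sigma:\mathbb{N}\to\mathbb{S}$ with $\sigma(i)\sqsubseteq\sigma(j)$ for $i\le j$. An element $\alpha\in\mathcal{S}X$ is an individual (strongly convergent) if for every weakly increasing $\sigma$ the sequence $\alpha(\sigma(i))$ is eventually constant. An interactive realizer is a map $r:\mathbb{S}\to\mathbb{S}$ which is strongly convergent, such that $r(s)$ is compatible with $s$ and $r(s)\cap s=\emptyset$ for all $s$. Its prefix points are $\mathrm{Prefix}(r)=\{s\mid r(s)\sqsubseteq s\}$. For $A$ with free variables among $x_1,\ldots,x_k$ and $\vec\alpha\in(\mathcal{S}\mathbb{N})^k$, $r\Vdash\vec\alpha:A$ means: for every $s\in\mathrm{Prefix}(r)$, $[\![A]\!]_{[\lambda\_.\alpha_1(s)/x_1,\ldots,\lambda\_.\alpha_k(s)/x_k]}(s)=\mathsf{true}$. *)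

(* Defs.v *)
From HB Require Import structures.
From mathcomp Require Import all_boot finmap.

Set Implicit Arguments.
Unset Strict Implicit.
Unset Printing Implicit Defensive.

Local Open Scope fset_scope.
Local Open Scope nat_scope.

(* [PRec f g] recurses on its first argument:
   h(0, v) = f(v) and h(n + 1, v) = g(n, h(n, v), v). *)
Inductive primrec : nat -> Type :=
| PZero k : primrec k
| PSucc : primrec 1
| PProj k (i : 'I_k) : primrec k
| PComp k m (f : primrec m) (g : {ffun 'I_m -> primrec k}) : primrec k
| PRec k (f : primrec k) (g : primrec k.+2) : primrec k.+1.

Fixpoint peval k (c : primrec k) : k.-tuple nat -> nat :=
  match c in primrec k return k.-tuple nat -> nat with
  | PZero _ => fun=> 0
  | PSucc => fun v => (thead v).+1
  | PProj _ i => fun v => tnth v i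
  | PComp _ m f g => fun v => peval f [tuple peval (g i) v | i < m]
  | PRec _ f g => fun v =>
      let w := behead_tuple v in
      nat_rect (fun=> nat) (peval f w)
        (fun n y => peval g (cons_tuple n (cons_tuple y w))) (thead v)
  end.

(* Trees are numbered effectively by the library's [pickle]; going through them
   gives both the decidable equality and the Goedel numbers of definitions. *)
Fixpoint primrec_tree k (c : primrec k) : GenTree.tree nat :=
  match c with
  | PZero _ => GenTree.Node 0 [::]
  | PSucc => GenTree.Node 1 [::]
  | PProj _ i => GenTree.Node 2 [:: GenTree.Leaf (i : nat)]
  | PComp _ m f g =>
      GenTree.Node 3 [:: GenTree.Leaf m, primrec_tree f
                       & [seq primrec_tree (g i) | i <- enum 'I_m]]
  | PRec _ f g => GenTree.Node 4 [:: primrec_tree f; primrec_tree g]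
  end.

Fixpoint tree_primrec (k : nat) (t : GenTree.tree nat) : primrec k :=
  match t with
  | GenTree.Node 1 _ => if k is 1 then PSucc else PZero _
  | GenTree.Node 2 [:: GenTree.Leaf i] =>
      if insub i is Some j then PProj j else PZero k
  | GenTree.Node 3 [:: GenTree.Leaf m, tf & tg] =>
      let ds := [seq tree_primrec k u | u <- tg] in
      PComp (tree_primrec m tf) [ffun i : 'I_m => nth (PZero k) ds i]
  | GenTree.Node 4 [:: tf; tg] =>
      if k is k'.+1 then PRec (tree_primrec k' tf) (tree_primrec k'.+2 tg)
      else PZero _
  | _ => PZero k
  end.

Fixpoint primrec_treeK k (c : primrec k) :
  tree_primrec k (primrec_tree c) = c.
Proof.
case: c => {k} [k||k i|k m f g|k f g] //=.
- by rewrite valK.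
- rewrite primrec_treeK; congr PComp; apply/ffunP=> i; rewrite ffunE.
  rewrite -map_comp (nth_map i) ?size_enum_ord // nth_ord_enum.
  exact: primrec_treeK.
- by rewrite !primrec_treeK.
Qed.

HB.instance Definition _ k :=
  Countable.copy (primrec k) (can_type (@primrec_treeK k)).

(* A predicate symbol is the syntactic definition of a representing function;
   the predicate holds exactly where this function takes the value 0. *)
Definition holds k (P : primrec k) (v : k.-tuple nat) : bool :=
  peval P v == 0.

Definition ppred : primrec 1 := PRec (PZero 0) (PProj (inord 0 : 'I_2)).
(* the function (y, x) |-> x - y (truncated) *)
Definition psubr : primrec 2 :=
  PRec (PProj (ord0 : 'I_1)) (PComp ppred [ffun=> PProj (inord 1 : 'I_3)]).
Definition padd : primrec 2 :=
  PRec (PProj (ord0 : 'I_1)) (PComp PSucc [ffun=> PProj (inord 1 : 'I_3)]).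
Definition pflip (f : primrec 2) : primrec 2 :=
  PComp f [ffun i => PProj (rev_ord i)].
(* |x - y|, which represents the equality predicate *)
Definition peq : primrec 2 :=
  PComp padd (finfun (tnth [tuple psubr; pflip psubr])).

Lemma peval_rec0 k (f : primrec k) g (v : k.-tuple nat) :
  peval (PRec f g) [tuple of 0 :: v] = peval f v.
Proof. by rewrite /=; congr (peval f _); apply: val_inj. Qed.

Lemma peval_recS k (f : primrec k) g n (v : k.-tuple nat) :
  peval (PRec f g) [tuple of n.+1 :: v] =
  peval g [tuple of n :: peval (PRec f g) [tuple of n :: v] :: v].
Proof.
have e i : behead_tuple [tuple of i :: v] = v by exact: val_inj.
by cbn [peval]; rewrite !e.
Qed.

Lemma holds_peq (a b : nat) : holds peq [tuple a; b] = (a == b).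
Proof.
have pred1 n : peval ppred [tuple n] = n.-1.
  have -> : [tuple n] = [tuple of n :: [tuple]] by exact: val_inj.
  case: n => [|n]; rewrite ?peval_rec0 ?peval_recS //= (tnth_nth 0) /=.
  by rewrite inordK.
have step c u r v :
    peval (PComp c [ffun=> PProj (inord 1 : 'I_3)]) [tuple u; r; v] =
    peval c [tuple r].
  rewrite /=; congr (peval c _); apply/eq_from_tnth => i.
  by rewrite tnth_mktuple ffunE /= ord1 !(tnth_nth 0) /= inordK.
have addE u v : peval padd [tuple u; v] = u + v.
  have tE n : [tuple n; v] = [tuple of n :: [tuple v]] by exact: val_inj.
  elim: u => [|u IH]; rewrite tE; first by rewrite peval_rec0 /= (tnth_nth 0).
  by rewrite peval_recS -tE [X in _ = X]addSn -IH; exact: step.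
have subE u v : peval psubr [tuple u; v] = v - u.
  have tE n : [tuple n; v] = [tuple of n :: [tuple v]] by exact: val_inj.
  elim: u => [|u IH]; rewrite tE.
    by rewrite peval_rec0 /= (tnth_nth 0) subn0.
  by rewrite peval_recS -tE subnS -IH -pred1; exact: step.
have flipE f u v : peval (pflip f) [tuple u; v] = peval f [tuple v; u].
  rewrite /=; congr (peval f _); apply/eq_from_tnth => i.
  rewrite tnth_mktuple ffunE.
  by case: i => [[|[|i]] hi] //=; rewrite !(tnth_nth 0).
have -> : holds peq [tuple a; b] = ((b - a) + (a - b) == 0).
  rewrite -(subE a b) -(subE b a) -(flipE psubr a b) -addE /holds /peq.
  congr (_ == 0); cbn [peval peq]; congr (peval padd _).
  apply/eq_from_tnth => i.
  rewrite tnth_mktuple ffunE.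
  by case: i => [[|[|i]] hi] //=; rewrite !(tnth_nth 0).
by rewrite addn_eq0 !subn_eq0 andbC -eqn_leq.
Qed.

Inductive term : Type :=
| Var (x : nat)
| Zero
| Succ (t : term)
| Fun k (f : primrec k) (ts : {ffun 'I_k -> term})
| Phi k (P : primrec k.+1) (ts : {ffun 'I_k -> term}).

Inductive formula : Type :=
| Atom k (Q : primrec k) (ts : {ffun 'I_k -> term})
| Chi k (P : primrec k.+1) (ts : {ffun 'I_k -> term})
| Neg (A : formula)
| And (A B : formula)
| Or (A B : formula)
| Imp (A B : formula).

Definition args k (ts : k.-tuple term) : {ffun 'I_k -> term} :=
  finfun (tnth ts).

Definition Eq (t u : term) : formula := Atom peq (args [tuple t; u]).

Fixpoint tfv (t : term) : seq nat :=
  match t with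
  | Var x => [:: x]
  | Zero => [::]
  | Succ t => tfv t
  | Fun k _ ts => flatten [seq tfv (ts i) | i <- enum 'I_k]
  | Phi k _ ts => flatten [seq tfv (ts i) | i <- enum 'I_k]
  end.

Fixpoint fv (A : formula) : seq nat :=
  match A with
  | Atom k _ ts => flatten [seq tfv (ts i) | i <- enum 'I_k]
  | Chi k _ ts => flatten [seq tfv (ts i) | i <- enum 'I_k]
  | Neg A => fv A
  | And A B | Or A B | Imp A B => fv A ++ fv B
  end.

Fixpoint tsubst (x : nat) (u t : term) : term :=
  match t with
  | Var y => if y == x then u else Var y
  | Zero => Zero
  | Succ t => Succ (tsubst x u t)
  | Fun k f ts => Fun f [ffun i => tsubst x u (ts i)]
  | Phi k P ts => Phi P [ffun i => tsubst x u (ts i)]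
  end.

Fixpoint subst (x : nat) (u : term) (A : formula) : formula :=
  match A with
  | Atom k Q ts => Atom Q [ffun i => tsubst x u (ts i)]
  | Chi k P ts => Chi P [ffun i => tsubst x u (ts i)]
  | Neg A => Neg (subst x u A)
  | And A B => And (subst x u A) (subst x u B)
  | Or A B => Or (subst x u A) (subst x u B)
  | Imp A B => Imp (subst x u A) (subst x u B)
  end.

Inductive logical_axiom : formula -> Prop :=
| ax_K A B : logical_axiom (Imp A (Imp B A))
| ax_S A B C :
    logical_axiom (Imp (Imp A (Imp B C)) (Imp (Imp A B) (Imp A C)))
| ax_andI A B : logical_axiom (Imp A (Imp B (And A B)))
| ax_andE1 A B : logical_axiom (Imp (And A B) A)
| ax_andE2 A B : logical_axiom (Imp (And A B) B)
| ax_orI1 A B : logical_axiom (Imp A (Or A B))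
| ax_orI2 A B : logical_axiom (Imp B (Or A B))
| ax_orE A B C :
    logical_axiom (Imp (Imp A C) (Imp (Imp B C) (Imp (Or A B) C)))
| ax_negI A B : logical_axiom (Imp (Imp A B) (Imp (Imp A (Neg B)) (Neg A)))
| ax_negE A B : logical_axiom (Imp (Neg A) (Imp A B))
| ax_eq_refl t : logical_axiom (Eq t t)
| ax_eq_repl x t u A :
    logical_axiom (Imp (Eq t u) (Imp (subst x t A) (subst x u A))).

Inductive nonlogical_axiom : formula -> Prop :=
| ax_zero k (ts : k.-tuple term) :
    nonlogical_axiom (Eq (Fun (PZero k) (args ts)) Zero)
| ax_succ t : nonlogical_axiom (Eq (Fun PSucc (args [tuple t])) (Succ t))
| ax_proj k (i : 'I_k) (ts : k.-tuple term) :
    nonlogical_axiom (Eq (Fun (PProj i) (args ts)) (tnth ts i))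
| ax_comp k m (f : primrec m) (g : {ffun 'I_m -> primrec k})
    (ts : k.-tuple term) :
    nonlogical_axiom
      (Eq (Fun (PComp f g) (args ts))
          (Fun f (args [tuple Fun (g i) (args ts) | i < m])))
| ax_rec0 k (f : primrec k) (g : primrec k.+2) (ts : k.-tuple term) :
    nonlogical_axiom
      (Eq (Fun (PRec f g) (args [tuple of Zero :: ts])) (Fun f (args ts)))
| ax_recS k (f : primrec k) (g : primrec k.+2) t (ts : k.-tuple term) :
    nonlogical_axiom
      (Eq (Fun (PRec f g) (args [tuple of Succ t :: ts]))
          (Fun g (args [tuple of
             t :: Fun (PRec f g) (args [tuple of t :: ts]) :: ts])))
(* the defining equivalence P(ts) <-> f(ts) = 0 of the predicate symbol
   represented by f *)
| ax_predE k (P : primrec k) (ts : k.-tuple term) :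
    nonlogical_axiom (Imp (Atom P (args ts)) (Eq (Fun P (args ts)) Zero))
| ax_predI k (P : primrec k) (ts : k.-tuple term) :
    nonlogical_axiom (Imp (Eq (Fun P (args ts)) Zero) (Atom P (args ts)))
| ax_succ_neq0 : nonlogical_axiom (Neg (Eq (Succ Zero) Zero))
| ax_chi k (P : primrec k.+1) (ts : k.-tuple term) u :
    nonlogical_axiom
      (Imp (Atom P (args [tuple of rcons ts u])) (Chi P (args ts)))
| ax_phi k (P : primrec k.+1) (ts : k.-tuple term) :
    nonlogical_axiom
      (Imp (Chi P (args ts))
           (Atom P (args [tuple of rcons ts (Phi P (args ts))]))).

(* No rule discharges a hypothesis, so the proviso of the substitution rule is
   void in derivations from no hypotheses, the only ones [PRA_EM1] considers;
   the induction rule has no proviso. *)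
Inductive derives : (formula -> Prop) -> formula -> Prop :=
| d_hyp (Gamma : formula -> Prop) A : Gamma A -> derives Gamma A
| d_logical Gamma A : logical_axiom A -> derives Gamma A
| d_nonlogical Gamma A : nonlogical_axiom A -> derives Gamma A
| d_mp Gamma A B :
    derives Gamma (Imp A B) -> derives Gamma A -> derives Gamma B
| d_subst (Gamma Delta : formula -> Prop) x t A :
    (forall B, Delta B -> Gamma B) ->
    (forall B, Delta B -> x \notin fv B) ->
    derives Delta A -> derives Gamma (subst x t A)
| d_ind Gamma x y A :
    derives Gamma (subst x Zero A) ->
    derives Gamma (Imp A (subst x (Succ (Var x)) A)) ->
    derives Gamma (subst x (Var y) A).

Definition PRA_EM1 (A : formula) : Prop := derives (fun=> False) A.

Definition instance : Type := {k : nat & (primrec k.+1 * k.-tuple nat)%type}.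

Definition inst k (P : primrec k.+1) (m : k.-tuple nat) : instance :=
  Tagged (fun k => (primrec k.+1 * k.-tuple nat)%type) (P, m).

Definition triple : Type := (instance * nat)%type.

Definition true_triple (t : triple) : bool :=
  let: (existT k (P, m), n) := t in holds P [tuple of rcons m n].

(* The second conjunct says that s is the graph of a partial function. *)
Definition is_state (s : {fset triple}) : bool :=
  all true_triple s && allrel (fun t u => (t.1 == u.1) ==> (t.2 == u.2)) s s.

Definition state : Type := {s : {fset triple} | is_state s}.

Definition state_le (s s' : state) : Prop := val s `<=` val s'.

Definition compatible (s s' : state) : Prop := is_state (val s `|` val s').

Definition chi k (P : primrec k.+1) (m : k.-tuple nat) (s : state) : bool :=
  has (fun t : triple => t.1 == inst P m) (val s).

Definition phi k (P : primrec k.+1) (m : k.-tuple nat) (s : state) : nat :=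
  head 0 [seq t.2 | t : triple <- val s & t.1 == inst P m].

Definition env : Type := nat -> state -> nat.

Fixpoint tinterp (xi : env) (t : term) (s : state) : nat :=
  match t with
  | Var x => xi x s
  | Zero => 0
  | Succ t => (tinterp xi t s).+1
  | Fun k f ts => peval f [tuple tinterp xi (ts i) s | i < k]
  | Phi k P ts => phi P [tuple tinterp xi (ts i) s | i < k] s
  end.

Fixpoint interp (xi : env) (A : formula) (s : state) : bool :=
  match A with
  | Atom k Q ts => holds Q [tuple tinterp xi (ts i) s | i < k]
  | Chi k P ts => chi P [tuple tinterp xi (ts i) s | i < k] s
  | Neg A => ~~ interp xi A s
  | And A B => interp xi A s && interp xi B s
  | Or A B => interp xi A s || interp xi B s
  | Imp A B => interp xi A s ==> interp xi B s
  end.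

Definition weakly_increasing (sigma : nat -> state) : Prop :=
  forall i j, i <= j -> state_le (sigma i) (sigma j).

Definition strongly_convergent (X : Type) (a : state -> X) : Prop :=
  forall sigma, weakly_increasing sigma ->
    exists n, forall i, n <= i -> a (sigma i) = a (sigma n).

Definition interactive_realizer (r : state -> state) : Prop :=
  [/\ strongly_convergent r,
      forall s, compatible (r s) s &
      forall s, val (r s) `&` val s = fset0].

Definition prefix_point (r : state -> state) (s : state) : Prop :=
  state_le (r s) s.

(* The environment [lambda _. a_1(s) / x_1, ..., lambda _. a_k(s) / x_k],
   constantly 0 elsewhere. *)
Definition env_at k (x : k.-tuple nat) (a : k.-tuple (state -> nat))
    (s : state) : env :=
  fun y _ => nth 0 [seq b s | b <- a] (index y x).

Definition realizes (r : state -> state) k (x : k.-tuple nat)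
    (a : k.-tuple (state -> nat)) (A : formula) : Prop :=
  forall s, prefix_point r s -> interp (env_at x a s) A s = true.

(* Programs for Kleene's partial recursive functions relative to [o] oracles. *)
Inductive recfun (o : nat) : nat -> Type :=
| RZero k : recfun o k
| RSucc : recfun o 1
| RProj k (i : 'I_k) : recfun o k
| RComp k m (f : recfun o m) (g : {ffun 'I_m -> recfun o k}) : recfun o k
| RRec k (f : recfun o k) (g : recfun o k.+2) : recfun o k.+1
| RMin k (f : recfun o k.+1) : recfun o k
| ROracle (i : 'I_o) : recfun o 1.

Arguments RZero {o} k.
Arguments RSucc {o}.
Arguments RProj {o k} i.

(* [computes O c v y]: on input [v], [c] halts with output [y], where an
   oracle query [x] to the [i]-th oracle is answered by [z] when [O i x z]. *)
Inductive computes o (O : 'I_o -> nat -> nat -> Prop) :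
  forall k, recfun o k -> k.-tuple nat -> nat -> Prop :=
| c_zero k (v : k.-tuple nat) : computes O (RZero k) v 0
| c_succ n : computes O RSucc [tuple n] n.+1
| c_proj k (i : 'I_k) v : computes O (RProj i) v (tnth v i)
| c_comp k m (f : recfun o m) (g : {ffun 'I_m -> recfun o k})
    (v : k.-tuple nat) (w : m.-tuple nat) y :
    (forall i, computes O (g i) v (tnth w i)) ->
    computes O f w y -> computes O (RComp f g) v y
| c_rec0 k (f : recfun o k) (g : recfun o k.+2) (v : k.-tuple nat) y :
    computes O f v y -> computes O (RRec f g) [tuple of 0 :: v] y
| c_recS k (f : recfun o k) (g : recfun o k.+2) n (v : k.-tuple nat) z y :
    computes O (RRec f g) [tuple of n :: v] z ->
    computes O g [tuple of n :: z :: v] y ->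
    computes O (RRec f g) [tuple of n.+1 :: v] y
| c_min k (f : recfun o k.+1) (v : k.-tuple nat) (w : nat -> nat) y :
    (forall n, n < y -> computes O f [tuple of n :: v] (w n).+1) ->
    computes O f [tuple of y :: v] 0 -> computes O (RMin f) v y
| c_oracle i x z : O i x z -> computes O (ROracle i) [tuple x] z.

Definition triple_code (t : triple) : nat :=
  let: (existT k (P, m), n) := t in
  CodeSeq.code (choice.pickle P :: rcons m n).

(* The canonical index of the finite set of the codes of the triples of s. *)
Definition state_code (s : state) : nat :=
  \sum_(t <- val s) 2 ^ triple_code t.

Lemma triple_code_inj : injective triple_code.
Proof.
move=> [[k [P m]] n] [[k' [P' m']] n'].
move/(can_inj CodeSeq.codeK) => [eqP /rcons_inj [eqm eqn]].
have eqk : k = k' by rewrite -(size_tuple m) -(size_tuple m') eqm.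
subst k' n'; have -> : m' = m by exact: val_inj.
have -> // : P' = P.
exact: (pcan_inj choice.pickleK).
Qed.

Lemma state_code_inj : injective state_code.
Proof.
have sumE (u : seq nat) : \sum_(i <- u) 2 ^ i =
    count_mem 0 u + (\sum_(i <- [seq i.-1 | i <- u & 0 < i]) 2 ^ i).*2.
  elim: u => [|[|i] u IH]; rewrite ?big_nil //= !big_cons IH //.
  by rewrite add0n expnS mul2n doubleD addnCA.
have sum_inj x : forall u v : seq nat, uniq u -> uniq v ->
    \sum_(i <- u) 2 ^ i = \sum_(i <- v) 2 ^ i -> (x \in u) = (x \in v).
  have predK (w : seq nat) y :
      (y \in [seq i.-1 | i <- w & 0 < i]) = (y.+1 \in w).
    apply/mapP/idP => [[i]|yw]; last by exists y.+1; rewrite ?mem_filter.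
    by rewrite mem_filter => /andP[i_gt0 iw] ->; rewrite prednK.
  have pred_uniq (w : seq nat) : uniq w -> uniq [seq i.-1 | i <- w & 0 < i].
    move=> w_uniq; rewrite map_inj_in_uniq ?filter_uniq // => -[|i] [|j] //;
      by rewrite !mem_filter //= => _ _ ->.
  elim: x => [|x IH] u v u_uniq v_uniq;
    rewrite (sumE u) (sumE v) !count_uniq_mem // => e.
    by move/(congr1 odd): e; rewrite !oddD !odd_double !addbF !oddb.
  rewrite -!predK; apply: IH; rewrite ?pred_uniq //.
  by move/(congr1 half): e; rewrite !half_bit_double.
move=> s s' e; apply: val_inj; apply/fsetP => t.
have code_uniq (u : state) : uniq [seq triple_code t | t <- val u].
  by rewrite (map_inj_uniq triple_code_inj) fset_uniq.
have := sum_inj (triple_code t) _ _ (code_uniq s) (code_uniq s').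
by rewrite !big_map !(mem_map triple_code_inj); apply.
Qed.

(* Functions on states are computed on the codes of states; an oracle is
   defined only on such codes. *)
Definition recursive_in k (a : k.-tuple (state -> nat)) (r : state -> state) :
    Prop :=
  exists c : recfun k 1, forall s,
    computes (fun i x z => exists2 s', x = state_code s' & z = tnth a i s')
      c [tuple state_code s] (state_code (r s)).

(* Main.v *)
Require Import Defs.
From mathcomp Require Import all_boot finmap.
From Stdlib Require Import Classical ClassicalEpsilon.

(* The realizer does not follow the derivation of A. At a state s it returns
   the empty state if A holds at s, and otherwise the true triple of least code
   that could be added to s, among those for the finitely many predicate
   symbols P whose chi-axioms are used in the derivation. Such a triple exists:
   along an increasing sequence of states that eventually decides chi_P
   correctly for these P, every theorem is eventually true (induction on the
   derivation), and a constant sequence at a state with nothing to add is of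
   this kind. The same fact gives strong convergence: an increasing sequence
   along which A stays false leaves some triple to be added forever, so the
   least code of an addable triple stabilizes. As only finitely many symbols
   are involved, no universal function for the primitive recursive functions is
   needed to compute the realizer. *)

Set Implicit Arguments.
Unset Strict Implicit.
Unset Printing Implicit Defensive.

Local Open Scope fset_scope.
Local Open Scope nat_scope.

(** * Interpretation of terms and formulas under substitution *)

(** The generated principle gives no hypothesis for subterms nested in a finite function. The motive
    is valued in [Type] because the same induction later builds programs. *)
Fixpoint term_rect_ffun (Q : term -> Type)
    (HV : forall x, Q (Var x)) (H0 : Q Zero) (HS : forall t, Q t -> Q (Succ t))
    (HF : forall k (f : primrec k) (ts : {ffun 'I_k -> term}),
       (forall i, Q (ts i)) -> Q (Fun f ts))
    (HP : forall k (P : primrec k.+1) (ts : {ffun 'I_k -> term}),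
       (forall i, Q (ts i)) -> Q (Phi P ts))
    (t : term) : Q t :=
  let IH := @term_rect_ffun Q HV H0 HS HF HP in
  match t with
  | Var x => HV x
  | Zero => H0
  | Succ t => HS t (IH t)
  | Fun k f ts => HF k f ts (fun i => IH (ts i))
  | Phi k P ts => HP k P ts (fun i => IH (ts i))
  end.

Definition upd (xi : env) (x : nat) (a : state -> nat) : env :=
  fun y => if y == x then a else xi y.

(** Every clause evaluates its parts at the same state, so a value that varies with the state can be
    replaced by the constant that it takes at [s]. *)
Lemma tinterp_ext (xi xi' : env) s t :
  (forall y, xi y s = xi' y s) -> tinterp xi t s = tinterp xi' t s.
Proof.
move=> e; elim/term_rect_ffun: t => [x||t IH|k f ts IH|k P ts IH] //=.
- by rewrite IH.
- by congr (peval f _); apply: eq_mktuple.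
- by congr (phi P _ s); apply: eq_mktuple.
Qed.

Lemma interp_ext (xi xi' : env) s A :
  (forall y, xi y s = xi' y s) -> interp xi A s = interp xi' A s.
Proof.
move=> e.
elim: A => [k Q ts|k P ts|A IH|A IHA B IHB|A IHA B IHB|A IHA B IHB] /=.
- by congr (holds Q _); apply: eq_mktuple => i; exact: tinterp_ext.
- by congr (chi P _ s); apply: eq_mktuple => i; exact: tinterp_ext.
- by rewrite IH.
- by rewrite IHA IHB.
- by rewrite IHA IHB.
- by rewrite IHA IHB.
Qed.

Lemma tinterp_subst xi x u s t :
  tinterp xi (tsubst x u t) s = tinterp (upd xi x (tinterp xi u)) t s.
Proof.
elim/term_rect_ffun: t => [y||t IH|k f ts IH|k P ts IH] //=.
- by rewrite /upd; case: eqP.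
- by rewrite IH.
- by congr (peval f _); apply: eq_mktuple => i; rewrite ffunE.
- by congr (phi P _ s); apply: eq_mktuple => i; rewrite ffunE.
Qed.

Lemma interp_subst xi x u s A :
  interp xi (subst x u A) s = interp (upd xi x (tinterp xi u)) A s.
Proof.
elim: A => [k Q ts|k P ts|A IH|A IHA B IHB|A IHA B IHB|A IHA B IHB] /=.
- by congr (holds Q _); apply: eq_mktuple => i; rewrite ffunE tinterp_subst.
- by congr (chi P _ s); apply: eq_mktuple => i; rewrite ffunE tinterp_subst.
- by rewrite IH.
- by rewrite IHA IHB.
- by rewrite IHA IHB.
- by rewrite IHA IHB.
Qed.

Lemma interp_Imp xi A B s :
  interp xi (Imp A B) s = (interp xi A s ==> interp xi B s).
Proof. by []. Qed.

Lemma mktuple_args (T : Type) k (F : term -> T) (ts : k.-tuple term) :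
  [tuple F (args ts i) | i < k] = map_tuple F ts.
Proof. by apply/eq_from_tnth => i; rewrite tnth_mktuple tnth_map ffunE. Qed.

Lemma interp_Eq xi t u s :
  interp xi (Eq t u) s = (tinterp xi t s == tinterp xi u s).
Proof.
rewrite -holds_peq /= (mktuple_args (fun t => tinterp xi t s)).
by congr (holds peq _); apply: val_inj.
Qed.

Lemma tinterp_Fun_args xi k (f : primrec k) (ts : k.-tuple term) s :
  tinterp xi (Fun f (args ts)) s =
  peval f (map_tuple (fun t => tinterp xi t s) ts).
Proof. by rewrite -mktuple_args. Qed.

(** * States as finite partial functions *)

Lemma chiP k (P : primrec k.+1) m s :
  reflect (exists n, (inst P m, n) \in val s) (chi P m s).
Proof.
apply: (iffP hasP) => [[[i n] ts /= /eqP <-]|[n ts]]; first by exists n.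
by exists (inst P m, n) => /=.
Qed.

Lemma state_holds (s : state) k (P : primrec k.+1) m n :
  (inst P m, n) \in val s -> holds P [tuple of rcons m n].
Proof. by case/andP: (valP s) => /allP/(_ (inst P m, n)). Qed.

Lemma state_fun (s : state) i n n' :
  (i, n) \in val s -> (i, n') \in val s -> n = n'.
Proof.
case/andP: (valP s) => _ /allrelP H h h'.
by have /= := H _ _ h h'; rewrite eqxx => /eqP.
Qed.

(** A state is single-valued, so every triple kept by the filter, in particular the head, carries
    [n]. *)
Lemma phiE (s : state) k (P : primrec k.+1) m n :
  (inst P m, n) \in val s -> phi P m s = n.
Proof.
move=> h; rewrite /phi.
have : (inst P m, n) \in [seq t : triple <- val s | t.1 == inst P m].
  by rewrite mem_filter eqxx.
case e: [seq t : triple <- val s | t.1 == inst P m] => [|[i n'] l] //= _.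
have : (i, n') \in [seq t : triple <- val s | t.1 == inst P m].
  by rewrite e mem_head.
by rewrite mem_filter /= => /andP[/eqP -> h']; exact: state_fun h' h.
Qed.

Lemma phi_nchi (s : state) k (P : primrec k.+1) m :
  ~~ chi P m s -> phi P m s = 0.
Proof.
move=> h; rewrite /phi.
suff -> : [seq t : triple <- val s | t.1 == inst P m] = [::] by [].
by apply/eqP; rewrite -(negbK (_ == _)) -has_filter.
Qed.

(** * Eventual truth and convergence of sequences *)

Definition eventually (Q : nat -> Prop) : Prop :=
  exists N, forall i, N <= i -> Q i.

Lemma eventually_true (Q : nat -> Prop) : (forall i, Q i) -> eventually Q.
Proof. by exists 0. Qed.

Lemma eventually_mono2 (Q Q' R : nat -> Prop) :
  (forall i, Q i -> Q' i -> R i) -> eventually Q -> eventually Q' ->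
  eventually R.
Proof.
move=> h [N hN] [N' hN']; exists (maxn N N') => i.
by rewrite geq_max => /andP[/hN q /hN' q']; exact: h.
Qed.

Lemma eventually_mono (Q R : nat -> Prop) :
  (forall i, Q i -> R i) -> eventually Q -> eventually R.
Proof. by move=> h [N hN]; exists N => i /hN; exact: h. Qed.

Lemma eventually_all (I : finType) (Q : I -> nat -> Prop) :
  (forall j, eventually (Q j)) -> eventually (fun i => forall j, Q j i).
Proof.
move=> h.
suff: eventually (fun i => forall j, j \in enum I -> Q j i).
  by apply: eventually_mono => i H j; apply: H; rewrite mem_enum.
elim: (enum I) => [|a l IH]; first exact: eventually_true.
apply: (eventually_mono2 _ (h a) IH) => i qa ql j.
by rewrite inE => /predU1P[->|/ql].
Qed.

Lemma eventually_ltn (Q : nat -> nat -> Prop) b :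
  (forall j, j < b -> eventually (Q j)) ->
  eventually (fun i => forall j, j < b -> Q j i).
Proof.
move=> h.
have := @eventually_all 'I_b (fun j => Q j) (fun j => h j (ltn_ord j)).
by apply: eventually_mono => i H j lt_jb; exact: (H (Ordinal lt_jb)).
Qed.

Lemma eventually_false : ~ eventually (fun=> False).
Proof. by case=> N /(_ N (leqnn N)). Qed.

Definition converges (X : Type) (a : nat -> X) : Prop :=
  exists v, eventually (fun i => a i = v).

Lemma converges_map (X Y : Type) (f : X -> Y) (a : nat -> X) :
  converges a -> converges (fun i => f (a i)).
Proof. by move=> [v h]; exists (f v); apply: eventually_mono h => i ->. Qed.

Lemma converges_map2 (X Y Z : Type) (f : X -> Y -> Z) a b :
  converges a -> converges b -> converges (fun i => f (a i) (b i)).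
Proof.
move=> [v h] [w h']; exists (f v w).
by apply: eventually_mono2 h h' => i -> ->.
Qed.

Lemma converges_mktuple (X : Type) k (a : 'I_k -> nat -> X) :
  (forall j, converges (a j)) -> converges (fun i => [tuple a j i | j < k]).
Proof.
move=> h.
have [v hv] : exists v, forall j, eventually (fun i => a j i = v j).
  pose w j := constructive_indefinite_description _ (h j).
  by exists (fun j => proj1_sig (w j)) => j; case: (w j).
exists [tuple v j | j < k]; apply: eventually_mono (eventually_all hv) => i e.
exact: eq_mktuple.
Qed.

(** * Convergence of interpretations along increasing sequences of states *)

Section Sequences.
Variable sigma : nat -> state.
Hypothesis wi : weakly_increasing sigma.

Lemma chi_mono k (P : primrec k.+1) m i j :
  i <= j -> chi P m (sigma i) -> chi P m (sigma j).
Proof.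
move=> /wi/fsubsetP le_ij /chiP[n h].
by apply/chiP; exists n; exact: le_ij.
Qed.

(** Along the sequence [chi] can change only once, from false to true. Before the change [phi] is 0;
    afterwards the stored triple persists and fixes its value. Which case occurs is decided
    classically. *)
Lemma chi_phi_converges k (P : primrec k.+1) m :
  converges (fun i => (chi P m (sigma i), phi P m (sigma i))).
Proof.
have [[N /chiP[n h]]|nch] := classic (exists i, chi P m (sigma i)).
  exists (true, n), N => i /wi/fsubsetP/(_ _ h) h'.
  by rewrite (phiE h'); congr pair; apply/chiP; exists n.
exists (false, 0); apply: eventually_true => i.
have /negP h : ~ chi P m (sigma i) by move=> h; case: nch; exists i.
by rewrite phi_nchi // (negbTE h).
Qed.

Lemma tinterp_converges (rho : nat -> nat) t :
  converges (fun i => tinterp (fun y _ => rho y) t (sigma i)).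
Proof.
elim/term_rect_ffun: t => [x||t IH|k f ts IH|k P ts IH] /=.
- by exists (rho x); exact: eventually_true.
- by exists 0; exact: eventually_true.
- exact: converges_map.
- exact/converges_map/converges_mktuple.
(* The arguments settle first, at some [m]; from then on only the values at this fixed [m]
   matter. *)
- have [m hm] := converges_mktuple IH.
  have [[b n] hn] := chi_phi_converges P m.
  by exists n; apply: eventually_mono2 hm hn => i -> [].
Qed.

Lemma interp_converges (rho : nat -> nat) A :
  converges (fun i => interp (fun y _ => rho y) A (sigma i)).
Proof.
elim: A => [k Q ts|k P ts|A IH|A IHA B IHB|A IHA B IHB|A IHA B IHB] /=.
- by apply/converges_map/converges_mktuple => j; exact: tinterp_converges.
- have [m hm] := converges_mktuple (fun j => tinterp_converges rho (ts j)).
  have [[b n] hn] := chi_phi_converges P m.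
  by exists b; apply: eventually_mono2 hm hn => i -> [].
- exact: converges_map.
- exact: converges_map2.
- exact: converges_map2.
- exact: (converges_map2 implb).
Qed.

End Sequences.

(** * Validity of derivable formulas on saturated sequences *)

(** At a single state the propositional axioms are Boolean tautologies. Replacement of equals holds
    because both substitutions update [x] by the same value at [s]. *)
Lemma logical_axiom_true xi A s : logical_axiom A -> interp xi A s.
Proof.
have tauto (b1 b2 b3 : bool) :
  [&& b1 ==> b2 ==> b1,
      (b1 ==> b2 ==> b3) ==> (b1 ==> b2) ==> b1 ==> b3,
      (b1 ==> b3) ==> (b2 ==> b3) ==> b1 || b2 ==> b3,
      (b1 ==> b2) ==> (b1 ==> ~~ b2) ==> ~~ b1 & ~~ b1 ==> b1 ==> b2].
  by case: b1; case: b2; case: b3.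
case=> [B C|B C D|B C|B C|B C|B C|B C|B C D|B C|B C|t|x t u B];
  rewrite ?interp_Eq //.
- by have /and5P[] := tauto (interp xi B s) (interp xi C s) true.
- by have /and5P[] := tauto (interp xi B s) (interp xi C s) (interp xi D s).
- by rewrite /=; case: (interp xi B s); case: (interp xi C s).
- by rewrite /=; case: (interp xi B s); case: (interp xi C s).
- by rewrite /=; case: (interp xi B s); case: (interp xi C s).
- by rewrite /=; case: (interp xi B s); case: (interp xi C s).
- by rewrite /=; case: (interp xi B s); case: (interp xi C s).
- by have /and5P[] := tauto (interp xi B s) (interp xi C s) (interp xi D s).
- by have /and5P[] := tauto (interp xi B s) (interp xi C s) true.
- by have /and5P[] := tauto (interp xi B s) (interp xi C s) true.
- rewrite !interp_Imp interp_Eq !interp_subst; apply/implyP => /eqP e.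
  rewrite -(@interp_ext (upd xi x (tinterp xi t))) ?implybb //.
  by move=> y; rewrite /upd; case: eqP.
Qed.

(** Eventual correctness of [chi] for the listed symbols; the converse direction is automatic, as
    states contain only true triples. The stage may depend on the instance. *)
Definition saturated (Ps : seq {k : nat & primrec k.+1})
    (sigma : nat -> state) : Prop :=
  forall k (P : primrec k.+1), Tagged (fun k => primrec k.+1) P \in Ps ->
  forall (m : k.-tuple nat) n, holds P [tuple of rcons m n] ->
  eventually (fun i => chi P m (sigma i)).

(** Variables stand for fixed numbers here, and the stage may depend on them. *)
Definition eventually_valid Ps A : Prop :=
  forall sigma, weakly_increasing sigma -> saturated Ps sigma ->
  forall rho : nat -> nat,
    eventually (fun i => interp (fun y _ => rho y) A (sigma i)).

Lemma saturated_cat Ps Ps' sigma :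
  saturated (Ps ++ Ps') sigma -> saturated Ps sigma /\ saturated Ps' sigma.
Proof.
by move=> sat; split=> k P PPs m n; apply: sat; rewrite mem_cat PPs ?orbT.
Qed.

(** Only a chi-axiom contributes a symbol to [Ps]; all other axioms hold at every state, the
    phi-axioms because the triples in a state are true. *)
Lemma nonlogical_axiom_valid A :
  nonlogical_axiom A -> exists Ps, eventually_valid Ps A.
Proof.
have pw B : (forall xi s, interp xi B s) -> exists Ps, eventually_valid Ps B.
  by move=> h; exists [::] => sigma _ _ rho; exact: eventually_true.
case=> {A} [k ts|t|k i ts|k m f g ts|k f g ts|k f g t ts|k P ts|k P ts|
  |k P ts u|k P ts].
- by apply: pw => xi s; rewrite interp_Eq.
- by apply: pw => xi s; rewrite interp_Eq tinterp_Fun_args.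
- by apply: pw => xi s; rewrite interp_Eq tinterp_Fun_args /= tnth_map.
- apply: pw => xi s; rewrite interp_Eq !tinterp_Fun_args /=; apply/eqP.
  congr (peval f _); apply/eq_from_tnth => i.
  by rewrite !(tnth_mktuple, tnth_map) tinterp_Fun_args.
- apply: pw => xi s; rewrite interp_Eq !tinterp_Fun_args -(peval_rec0 f g).
  apply/eqP.
  by congr (peval _ _); apply: val_inj.
- apply: pw => xi s; rewrite interp_Eq !tinterp_Fun_args; apply/eqP.
  set w := map_tuple (fun t => tinterp xi t s) ts.
  transitivity (peval (PRec f g) [tuple of (tinterp xi t s).+1 :: w]).
    by congr (peval _ _); apply: val_inj.
  have e : tinterp xi (Fun (PRec f g) (args [tuple of t :: ts])) s =
      peval (PRec f g) [tuple of tinterp xi t s :: w].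
    by rewrite tinterp_Fun_args; congr (peval _ _); apply: val_inj.
  by rewrite peval_recS -e; congr (peval g _); apply: val_inj.
- by apply: pw => xi s; rewrite interp_Imp interp_Eq; exact: implybb.
- by apply: pw => xi s; rewrite interp_Imp interp_Eq; exact: implybb.
- apply: pw => xi s.
  by rewrite -[interp _ _ _]/(~~ interp xi (Eq _ _) s) interp_Eq.
- exists [:: Tagged (fun k => primrec k.+1) P] => sigma wi sat rho /=.
  have [m hm] :=
    converges_mktuple (fun j => tinterp_converges wi rho (args ts j)).
  have [n hn] := tinterp_converges wi rho u.
  pose xi : env := fun y _ => rho y.
  have e i : [tuple tinterp xi (args ts j) (sigma i) | j < k] = m ->
      tinterp xi u (sigma i) = n ->
      [tuple tinterp xi (args [tuple of rcons ts u] j) (sigma i) | j < k.+1] =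
      [tuple of rcons m n].
    rewrite (mktuple_args (fun t => tinterp _ t _)).
    rewrite (mktuple_args (fun t => tinterp _ t _)) => <- <-.
    by apply: val_inj; rewrite /= map_rcons.
  (* If [P] holds at the limits, saturation makes the conclusion eventually true; otherwise the
     premise is eventually false. *)
  have [Pmn|Pmn] := boolP (holds P [tuple of rcons m n]).
    have hc := sat k P (mem_head _ _) m n Pmn.
    apply: eventually_mono2 hm hc => i -> ->; exact: implybT.
  apply: eventually_mono2 hm hn => i em en.
  by rewrite (e i em en) (negbTE Pmn).
- apply: pw => xi s /=.
  rewrite (mktuple_args (fun t => tinterp xi t s)).
  rewrite (mktuple_args (fun t => tinterp xi t s)).
  apply/implyP => /chiP[n h]; have := state_holds h.
  congr (holds P _); apply: val_inj; rewrite /= map_rcons /=; congr rcons.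
  by rewrite (mktuple_args (fun t => tinterp xi t s)) (phiE h).
Qed.

Lemma derives_eventually_valid Gamma A :
  derives Gamma A -> (forall B, ~ Gamma B) -> exists Ps, eventually_valid Ps A.
Proof.
elim=> {Gamma A} [Gamma A GA|Gamma A ax|Gamma A ax|Gamma A B _ IHAB _ IHA
  |Gamma Delta x t A sub _ _ IH|Gamma x y A _ IH0 _ IHS] nG.
- by case: (nG A).
- exists [::] => sigma _ _ rho.
  by apply: eventually_true => i; exact: logical_axiom_true.
- exact: nonlogical_axiom_valid.
- have [Ps h] := IHAB nG; have [Ps' h'] := IHA nG.
  exists (Ps ++ Ps') => sigma wi sat rho.
  have [sat1 sat2] := saturated_cat sat.
  apply: eventually_mono2 (h sigma wi sat1 rho) (h' sigma wi sat2 rho) => i.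
  by move/implyP.
- have [Ps h] := IH (fun B D => nG B (sub B D)); exists Ps => sigma wi sat rho.
  (* The value of [t] varies with the state but has a limit [v]; the premise is used with [v]
     assigned to [x]. *)
  have [v hv] := tinterp_converges wi rho t.
  have := h sigma wi sat (fun y => if y == x then v else rho y).
  apply: eventually_mono2 hv => i e.
  rewrite interp_subst; congr is_true; apply: interp_ext => z.
  by rewrite /upd; case: eqP.
- have [Ps h] := IH0 nG; have [Ps' h'] := IHS nG.
  exists (Ps ++ Ps') => sigma wi sat rho.
  have [sat1 sat2] := saturated_cat sat.
  (* The stage may grow with [n], since each step uses the induction premise at a new number; only
     the stage for [rho y] is used below. *)
  have all_n n : eventually (fun i =>
      interp (fun z _ => if z == x then n else rho z) A (sigma i)).
    elim: n => [|n IHn].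
      apply: eventually_mono (h sigma wi sat1 rho) => i.
      rewrite interp_subst; congr is_true; apply: interp_ext => z.
      by rewrite /upd; case: eqP.
    have := h' sigma wi sat2 (fun z => if z == x then n else rho z).
    apply: eventually_mono2 IHn => i An.
    rewrite interp_Imp An interp_subst; congr is_true; apply: interp_ext => z.
    by rewrite /upd /=; case: eqP => //; rewrite eqxx.
  apply: eventually_mono (all_n (rho y)) => i.
  rewrite interp_subst; congr is_true; apply: interp_ext => z.
  by rewrite /upd; case: eqP.
Qed.

(** * Bounded search *)

(* The value is [b] when [p] holds nowhere below [b]. *)
Definition find_below (p : nat -> bool) (b : nat) : nat := find p (iota 0 b).

Lemma find_below_le (p : nat -> bool) b : find_below p b <= b.
Proof. by rewrite -[leqRHS](size_iota 0) find_size. Qed.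

Lemma find_belowP (p : nat -> bool) b :
  (find_below p b == b) || p (find_below p b).
Proof.
rewrite /find_below; have [h|h] := boolP (has p (iota 0 b)).
  have := nth_find 0 h; rewrite nth_iota ?add0n => [->|]; rewrite ?orbT //.
  by move: h; rewrite has_find size_iota.
by rewrite hasNfind // size_iota eqxx.
Qed.

Lemma before_find_below (p : nat -> bool) b j :
  j < find_below p b -> (j < b) && ~~ p j.
Proof.
move=> h; have lt_jb := leq_trans h (find_below_le p b).
rewrite lt_jb /=; have := before_find 0 h.
by rewrite nth_iota ?add0n // => ->.
Qed.

Lemma find_below_eq (p : nat -> bool) b n :
  n < b -> p n -> (forall j, j < n -> ~~ p j) -> find_below p b = n.
Proof.
move=> lt_nb pn npj; case: (ltngtP (find_below p b) n) => // h.
  have := find_belowP p b; rewrite (negbTE (npj _ h)) orbF => /eqP e.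
  by move: h; rewrite e ltnNge ltnW.
by have := before_find_below h; rewrite pn andbF.
Qed.

(** * Programs relative to oracles *)

Section Computability.
Variables (o : nat) (alpha : o.-tuple (state -> nat)).

Definition oracle (i : 'I_o) (x z : nat) : Prop :=
  exists2 s', x = state_code s' & z = tnth alpha i s'.

(* The code of the state comes last, so that primitive recursion, which acts on
   the first argument, leaves it alone. *)
Definition computable n (F : state -> seq nat -> nat) : Type :=
  {c : recfun o n.+1 | forall s (v : n.-tuple nat),
     computes oracle c [tuple of rcons v (state_code s)] (F s v)}.

Lemma computable_ext n F G :
  (forall s v, F s v = G s v) -> computable n F -> computable n G.
Proof. by move=> e [c h]; exists c => s v; rewrite -e. Qed.

Lemma computes_proj k (i : 'I_k) (v : k.-tuple nat) y :
  y = tnth v i -> computes oracle (RProj i) v y.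
Proof. by move=> ->; exact: c_proj. Qed.

Lemma computable_zero n : computable n (fun _ _ => 0).
Proof. by exists (RZero _) => s v; exact: c_zero. Qed.

Lemma computable_nth n i : computable n (fun _ v => nth 0 v i).
Proof.
have [lt_in|le_ni] := ltnP i n.
  exists (RProj (Ordinal (leqW lt_in))) => s v; apply: computes_proj.
  by rewrite (tnth_nth 0) /= nth_rcons size_tuple lt_in.
exists (RZero _) => s v; rewrite nth_default ?size_tuple //; exact: c_zero.
Qed.

Lemma computable_code n : computable n (fun s _ => state_code s).
Proof.
exists (RProj ord_max) => s v; apply: computes_proj.
by rewrite (tnth_nth 0) /= nth_rcons size_tuple ltnn eqxx.
Qed.

Lemma computable_oracle n (i : 'I_o) : computable n (fun s _ => tnth alpha i s).
Proof.
have [c hc] := computable_code n.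
exists (RComp (ROracle i) [ffun=> c]) => s v.
apply: (@c_comp _ _ _ _ _ _ _ [tuple state_code s]); last first.
  by apply: c_oracle; exists s.
by move=> j; rewrite ffunE ord1 (tnth_nth 0).
Qed.

Lemma computable_comp_fin m n G (g : 'I_m -> state -> seq nat -> nat) :
  computable m G -> (forall i, computable n (g i)) ->
  computable n (fun s v => G s [seq g i s v | i <- enum 'I_m]).
Proof.
move=> [c hc] hg.
(* The last slot, [ord_max], forwards the code of the state to the outer program. *)
exists (RComp c [ffun j : 'I_m.+1 =>
  if unlift ord_max j is Some i then sval (hg i) else RProj ord_max]) => s v.
have := hc s [tuple g i s v | i < m].
apply: c_comp => j; rewrite ffunE.
case: unliftP => [i|] ->.
  set z := tnth _ _; have -> : z = g i s v; last exact: (svalP (hg i)).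
  rewrite /z (tnth_nth 0) [val _]/= nth_rcons size_map size_enum_ord lift_max.
  by rewrite ltn_ord -(tnth_mktuple (fun i => g i s v)) (tnth_nth 0).
apply: computes_proj; rewrite !(tnth_nth 0) /= !nth_rcons.
by rewrite size_map size_enum_ord size_tuple !ltnn !eqxx.
Qed.

Lemma computable_comp m n G (g : nat -> state -> seq nat -> nat) :
  computable m G -> (forall i, computable n (g i)) ->
  computable n (fun s v => G s (mkseq (fun i => g i s v) m)).
Proof.
move=> hG hg; have := computable_comp_fin hG (fun i : 'I_m => hg i).
apply: computable_ext => s v; congr (G s _).
by rewrite /mkseq -val_enum_ord -map_comp.
Qed.

(** Weakening by a new first argument, for expressions placed under a search variable. *)
Lemma computable_behead n b :
  computable n b -> computable n.+1 (fun s v => b s (behead v)).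
Proof.
move=> hb.
have [c hc] := computable_comp hb (fun i => computable_nth n.+1 i.+1).
exists c => s v; have := hc s v.
congr (computes _ _ _ (b s _)); case/tupleP: v => j v /=.
by rewrite -[RHS](mkseq_nth 0) size_tuple.
Qed.

Lemma computable_fun1 (f : nat -> nat) n a :
  computable 1 (fun _ v => f (nth 0 v 0)) ->
  computable n a -> computable n (fun s v => f (a s v)).
Proof. by move=> hf ha; exact: (computable_comp hf (fun=> ha)). Qed.

Lemma computable_fun2 (f : nat -> nat -> nat) n a b :
  computable 2 (fun _ v => f (nth 0 v 0) (nth 0 v 1)) ->
  computable n a -> computable n b ->
  computable n (fun s v => f (a s v) (b s v)).
Proof.
move=> hf ha hb.
have h i : computable n (nth b [:: a] i) by case: i => [|[|i]].
exact: (computable_comp hf h).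
Qed.

Lemma computable_rec n f g F :
  computable n f -> computable n.+2 g ->
  (forall s v, F s (0 :: v) = f s v) ->
  (forall s m v, F s (m.+1 :: v) = g s [:: m, F s (m :: v) & v]) ->
  computable n.+1 F.
Proof.
move=> [cf hf] [cg hg] F0 FS; exists (RRec cf cg) => s v.
case/tupleP: v => m v.
have e j : [tuple of rcons [tuple of j :: v] (state_code s)] =
    [tuple of j :: [tuple of rcons v (state_code s)]] by exact: val_inj.
rewrite e; elim: m => [|m IH]; first by rewrite F0; exact/c_rec0/hf.
rewrite FS; apply: c_recS IH _.
have := hg s [tuple of m :: F s (m :: v) :: v].
suff -> : [tuple of rcons [tuple of m :: F s (m :: v) :: v] (state_code s)] =
    [tuple of m :: F s (m :: v) :: [tuple of rcons v (state_code s)]] by [].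
exact: val_inj.
Qed.

(** Since [F] already names the first zero, the unbounded search halts on every input. *)
Lemma computable_min n f F :
  computable n.+1 f -> (forall s v, f s (F s v :: v) = 0) ->
  (forall s v m, m < F s v -> f s (m :: v) != 0) -> computable n F.
Proof.
move=> [c hc] F0 Fmin; exists (RMin c) => s v.
have e j : [tuple of j :: [tuple of rcons v (state_code s)]] =
    [tuple of rcons [tuple of j :: v] (state_code s)] by exact: val_inj.
(* The rule [c_min] records the nonzero values by their predecessors. *)
apply: (@c_min _ _ _ _ _ (fun j => (f s (j :: v)).-1)).
  by move=> j lt_j; rewrite e prednK ?lt0n ?Fmin //; exact: hc.
by rewrite e -(F0 s v); exact: hc.
Qed.

Fixpoint embed k (f : primrec k) : recfun o k :=
  match f with
  | PZero k => RZero k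
  | PSucc => RSucc
  | PProj k i => RProj i
  | PComp k m f g => RComp (embed f) [ffun i => embed (g i)]
  | PRec k f g => RRec (embed f) (embed g)
  end.

Fixpoint computes_embed k (f : primrec k) :
  forall v, computes oracle (embed f) v (peval f v).
Proof.
case: f => {k} [k|||k m f g|k f g] v.
- exact: c_zero.
- by case/tupleP: v => n v; rewrite (tuple0 v); exact: c_succ.
- exact: c_proj.
- apply: (c_comp (w := [tuple peval (g i) v | i < m]));
    last exact: computes_embed.
  by move=> i; rewrite ffunE tnth_mktuple; exact: computes_embed.
- case/tupleP: v => n v; elim: n => [|n IH].
    by rewrite peval_rec0; apply: c_rec0; exact: computes_embed.
  by rewrite peval_recS; apply: c_recS IH _; exact: computes_embed.
Qed.

Lemma computable_peval k (f : primrec k) n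
    (g : 'I_k -> state -> seq nat -> nat) :
  (forall i, computable n (g i)) ->
  computable n (fun s v => peval f [tuple g i s v | i < k]).
Proof.
move=> hg; exists (RComp (embed f) [ffun i => sval (hg i)]) => s v.
apply: c_comp (computes_embed _ _) => i.
by rewrite ffunE tnth_mktuple; exact: (svalP (hg i)).
Qed.

(** * Computable arithmetic *)

Lemma computable_succ n a :
  computable n a -> computable n (fun s v => (a s v).+1).
Proof.
move=> ha; have := computable_peval PSucc (fun=> ha).
by apply: computable_ext => s v /=; rewrite /thead tnth_mktuple.
Qed.

Lemma computable_const n m : computable n (fun _ _ => m).
Proof.
by elim: m => [|m IH]; [exact: computable_zero | exact: computable_succ].
Qed.

Lemma computable_add n a b : computable n a -> computable n b ->
  computable n (fun s v => a s v + b s v).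
Proof.
apply: computable_fun2.
exact: (computable_rec (computable_nth 1 0)
  (computable_succ (computable_nth 3 1))).
Qed.

Lemma computable_mul n a b : computable n a -> computable n b ->
  computable n (fun s v => a s v * b s v).
Proof.
apply: computable_fun2.
exact: (computable_rec (computable_zero 1)
  (computable_add (computable_nth 3 2) (computable_nth 3 1))).
Qed.

Lemma computable_sub n a b : computable n a -> computable n b ->
  computable n (fun s v => a s v - b s v).
Proof.
have pred m c : computable m c -> computable m (fun s v => (c s v).-1).
  apply: (computable_fun1 (f := predn)).
  exact: (computable_rec (computable_zero 0) (computable_nth 2 0)).
(* Recursion runs on the first argument, so the subtrahend is put first. *)
move=> ha hb; apply: (computable_fun2 (f := fun x y => y - x)) hb ha.
apply: (computable_rec (computable_nth 1 0) (pred _ _ (computable_nth 3 1))).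
  by move=> s v; rewrite /= subn0.
by move=> s m v; rewrite /= subnS.
Qed.

Lemma computable_exp2 n a :
  computable n a -> computable n (fun s v => 2 ^ a s v).
Proof.
apply: computable_fun1 => /=.
apply: (computable_rec (computable_const 0 1)
  (computable_add (computable_nth 2 1) (computable_nth 2 1))) => // s m v.
by rewrite /= expnS mul2n addnn.
Qed.

Lemma computable_odd n a :
  computable n a -> computable n (fun s v => odd (a s v)).
Proof.
apply: (computable_fun1 (f := fun x => odd x)) => /=.
apply: (computable_rec (computable_zero 0)
  (computable_sub (computable_const 2 1) (computable_nth 2 1))) => // s m v /=.
by case: (odd m).
Qed.

(** The parities of these iterates are the bits of [b]; codes of states and of sequences are read
    through them. *)
Lemma computable_iter_half n a b : computable n a -> computable n b ->
  computable n (fun s v => iter (a s v) half (b s v)).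
Proof.
have half_c m c : computable m c -> computable m (fun s v => (c s v)./2).
  apply: computable_fun1.
  apply: (computable_rec (computable_zero 0) (computable_add
    (computable_odd (computable_nth 2 0)) (computable_nth 2 1))) => // s p v.
  by rewrite /= uphalf_half.
apply: (computable_fun2 (f := fun x y => iter x half y)) => /=.
exact: (computable_rec (computable_nth 1 0) (half_c _ _ (computable_nth 3 1))).
Qed.

(** * Decidable predicates and computable searches *)

Definition decidable_in n (p : state -> seq nat -> bool) : Type :=
  computable n (fun s v => p s v).

Lemma decidable_ext n p q :
  (forall s v, p s v = q s v) -> decidable_in n p -> decidable_in n q.
Proof. by move=> e; apply: computable_ext => s v; rewrite e. Qed.

Lemma decidable_neg n p :
  decidable_in n p -> decidable_in n (fun s v => ~~ p s v).
Proof.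
move=> h; have := computable_sub (computable_const n 1) h.
by apply: computable_ext => s v; case: (p s v).
Qed.

Lemma decidable_and n p q : decidable_in n p -> decidable_in n q ->
  decidable_in n (fun s v => p s v && q s v).
Proof.
move=> h h'; have := computable_mul h h'.
by apply: computable_ext => s v; rewrite mulnb.
Qed.

Lemma decidable_or n p q : decidable_in n p -> decidable_in n q ->
  decidable_in n (fun s v => p s v || q s v).
Proof.
move=> h h'.
have := decidable_neg (decidable_and (decidable_neg h) (decidable_neg h')).
by apply: decidable_ext => s v; rewrite negb_and !negbK.
Qed.

Lemma decidable_eq n a b : computable n a -> computable n b ->
  decidable_in n (fun s v => a s v == b s v).
Proof.
move=> ha hb.
have := computable_sub (computable_const n 1)
  (computable_add (computable_sub ha hb) (computable_sub hb ha)).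
apply: computable_ext => s v.
by rewrite eqn_leq -!subn_eq0 -addn_eq0; case: (_ + _).
Qed.

Lemma decidable_odd n a :
  computable n a -> decidable_in n (fun s v => odd (a s v)).
Proof. exact: computable_odd. Qed.

Lemma decidable_holds k (P : primrec k) n g :
  (forall i, computable n (g i)) ->
  decidable_in n (fun s v => holds P [tuple g i s v | i < k]).
Proof.
by move=> hg; apply: decidable_eq (computable_peval P hg) (computable_zero n).
Qed.

Lemma computable_if n p a b :
  decidable_in n p -> computable n a -> computable n b ->
  computable n (fun s v => if p s v then a s v else b s v).
Proof.
move=> hp ha hb.
have := computable_add (computable_mul hp ha)
  (computable_mul (decidable_neg hp) hb).
apply: computable_ext => s v.
by case: (p s v); rewrite mul1n mul0n ?addn0.
Qed.

Lemma computable_find_below n p b :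
  decidable_in n.+1 p -> computable n b ->
  computable n (fun s v => find_below (fun j => p s (j :: v)) (b s v)).
Proof.
move=> hp hb.
(* Testing for the bound as well makes the minimization halt at [b] when no smaller candidate
   satisfies [p]. *)
apply: (computable_min (decidable_neg (decidable_or hp
  (decidable_eq (computable_nth _ 0) (computable_behead hb))))) => s v.
  by rewrite /= orbC find_belowP.
move=> m /before_find_below /andP[lt_mb /negbTE] /= ->.
by rewrite (ltn_eqF lt_mb).
Qed.

(** The list [l] is fixed outside the program, which is therefore an iterated composition and not a
    recursion over codes. *)
Lemma computable_seq_code n (I : Type) (g : I -> state -> seq nat -> nat)
    (l : seq I) :
  (forall i, computable n (g i)) ->
  computable n (fun s v => CodeSeq.code [seq g i s v | i <- l]).
Proof.
move=> hg; elim: l => [|i l IH] /=; first exact: computable_zero.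
have := computable_mul (computable_exp2 (hg i))
  (computable_succ (computable_add IH IH)).
by apply: computable_ext => s v; rewrite addnn.
Qed.

End Computability.

(** * Decoding sequences and states *)

(* [CodeSeq.code (n :: l)] is [2 ^ n * (CodeSeq.code l).*2.+1]. *)
Definition code_head y := find_below (fun j => odd (iter j half y)) y.
Definition code_tail y := (iter (code_head y) half y)./2.
Definition code_nth i y := code_head (iter i code_tail y).

Lemma iter_half_exp2 n m : iter n half (2 ^ n * m) = m.
Proof.
by elim: n => [|n IH]; rewrite ?mul1n // iterSr expnS -mulnA mul2n doubleK.
Qed.

(** The cofactor of [2 ^ n] is odd, so [n] is the first place with an odd iterate; it is smaller
    than the code, hence within the range of the search. *)
Lemma code_head_cons n l : code_head (CodeSeq.code (n :: l)) = n.
Proof.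
apply: find_below_eq.
- by have /= /andP[] := CodeSeq.ltn_code (n :: l).
- by rewrite /= iter_half_exp2 /= odd_double.
- move=> j lt_jn /=; rewrite -(subnKC lt_jn) addSnnS expnD -mulnA.
  by rewrite iter_half_exp2 expnS -mulnA mul2n odd_double.
Qed.

Lemma code_tail_cons n l : code_tail (CodeSeq.code (n :: l)) = CodeSeq.code l.
Proof.
by rewrite /code_tail code_head_cons /= iter_half_exp2 /= uphalf_double.
Qed.

Lemma code_nth_code l i : i < size l -> code_nth i (CodeSeq.code l) = nth 0 l i.
Proof.
rewrite /code_nth; elim: l i => [|n l IH] [|i] //=.
  by rewrite code_head_cons.
by rewrite ltnS -iterS iterSr code_tail_cons; exact: IH.
Qed.

(** Bit 0 of the sum tells whether 0 is in [u]; halving drops the exponent 0 and lowers the positive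
    ones by one. *)
Lemma odd_iter_half_sum_exp2 (u : seq nat) j :
  uniq u -> odd (iter j half (\sum_(i <- u) 2 ^ i)) = (j \in u).
Proof.
have predK (w : seq nat) i :
    (i \in [seq h.-1 | h <- w & 0 < h]) = (i.+1 \in w).
  apply/mapP/idP => [[h]|iw]; last by exists i.+1; rewrite ?mem_filter.
  by rewrite mem_filter => /andP[h_gt0 hw] ->; rewrite prednK.
have sumE (w : seq nat) : uniq w -> \sum_(i <- w) 2 ^ i =
    (0 \in w) + (\sum_(i <- [seq h.-1 | h <- w & 0 < h]) 2 ^ i).*2.
  move/count_uniq_mem <-.
  elim: w => [|[|h] w IH]; rewrite ?big_nil //= !big_cons.
    by rewrite IH.
  by rewrite IH add0n expnS mul2n doubleD addnCA.
elim: j u => [|j IH] u uniq_u.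
  by rewrite sumE //= oddD odd_double addbF oddb.
rewrite iterSr sumE // half_bit_double IH ?predK //.
rewrite map_inj_in_uniq ?filter_uniq //.
by move=> [|h] [|i] //; rewrite !mem_filter //= => _ _ ->.
Qed.

Lemma mem_state (s : state) t :
  (t \in val s) = odd (iter (triple_code t) half (state_code s)).
Proof.
rewrite -(mem_map triple_code_inj) -odd_iter_half_sum_exp2 ?big_map //.
by rewrite (map_inj_uniq triple_code_inj) fset_uniq.
Qed.

(** The value is below the code of its triple, which is below its power of 2, a summand of the code
    of [s]. This bounds the search for stored values. *)
Lemma mem_state_lt (s : state) i n : (i, n) \in val s -> n < state_code s.
Proof.
move=> h; have lt_n : n < triple_code (i, n).
  case: i {h} => k [P m].
  have /allP := CodeSeq.ltn_code (choice.pickle P :: rcons m n).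
  by apply; rewrite inE mem_rcons mem_head orbT.
apply: (leq_trans lt_n); apply: leq_trans (ltnW (ltn_expl _ (ltnSn 1))) _.
by rewrite /state_code (big_rem (i, n)) //= leq_addr.
Qed.

(** * Stored values and addable triples *)

(** A failed search returns [state_code s], which no triple of [s] has as its value. *)
Definition search k (P : primrec k.+1) m (s : state) :=
  find_below (fun j => (inst P m, j) \in val s) (state_code s).

Lemma chi_search k (P : primrec k.+1) m s :
  chi P m s = ((inst P m, search P m s) \in val s).
Proof.
apply/chiP/idP => [[n h]|]; last by exists (search P m s).
have := find_belowP (fun j => (inst P m, j) \in val s) (state_code s).
case/orP => // /eqP e.
have : n < search P m s by rewrite /search e; exact: mem_state_lt h.
by case/before_find_below/andP => _; rewrite h.
Qed.

Lemma phi_search k (P : primrec k.+1) m s :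
  phi P m s = if chi P m s then search P m s else 0.
Proof.
case: ifPn => [|/phi_nchi //]; rewrite chi_search; exact: phiE.
Qed.

(** In the sequence coding a triple, entry 0 is the number of the symbol, entries 1 to [k] are the
    arguments and entry [k.+1] is the value. Encoding again rejects every [y] that is not the code
    of a triple for [P]. *)
Definition new_code k (P : primrec k.+1) (s : state) (y : nat) : bool :=
  let m := [tuple code_nth i.+1 y | i < k] in let n := code_nth k.+1 y in
  [&& y == triple_code (inst P m, n), holds P [tuple of rcons m n] &
      ~~ chi P m s].

Lemma new_codeP k (P : primrec k.+1) s y :
  reflect (exists m n, [/\ y = triple_code (inst P m, n),
    holds P [tuple of rcons m n] & ~~ chi P m s]) (new_code P s y).
Proof.
apply: (iffP and3P) => [[/eqP e hP nchi]|[m [n [-> hP nchi]]]].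
  by exists [tuple code_nth i.+1 y | i < k], (code_nth k.+1 y).
have em : [tuple code_nth i.+1 (triple_code (inst P m, n)) | i < k] = m.
  apply/eq_from_tnth => i; rewrite tnth_mktuple code_nth_code /=.
    by rewrite nth_rcons size_tuple ltn_ord -tnth_nth.
  by rewrite size_rcons size_tuple !ltnS ltnW ?ltn_ord.
have en : code_nth k.+1 (triple_code (inst P m, n)) = n.
  rewrite code_nth_code /= ?size_rcons ?size_tuple //.
  by rewrite nth_rcons size_tuple ltnn eqxx.
by rewrite em en eqxx.
Qed.

Definition new_among (Ps : seq {k : nat & primrec k.+1}) s y : bool :=
  has (fun Q => new_code (tagged Q) s y) Ps.

(** A failure of saturation is a true instance for which [chi] is not eventually true; as [chi] is
    monotone, it is never true there, so one triple stays addable at every stage. *)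
Lemma not_saturated_new Ps sigma :
  weakly_increasing sigma -> ~ saturated Ps sigma ->
  exists y, forall i, new_among Ps (sigma i) y.
Proof.
move=> wi nsat; apply: NNPP => nex; apply: nsat => k P PPs m n hP.
apply: NNPP => nev; apply: nex; exists (triple_code (inst P m, n)) => i.
apply/hasP; exists (Tagged (fun k => primrec k.+1) P) => //.
apply/new_codeP; exists m, n; split => //; apply/negP => c.
by apply: nev; exists i => j le_ij; exact: chi_mono c.
Qed.

Lemma new_among_anti Ps (s s' : state) y :
  state_le s s' -> new_among Ps s' y -> new_among Ps s y.
Proof.
move=> le_s /hasP[Q QPs /new_codeP[m [n [e hP nchi]]]].
apply/hasP; exists Q => //; apply/new_codeP; exists m, n; split => //.
apply: contra nchi => /chiP[n' h]; apply/chiP; exists n'.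
exact: (fsubsetP le_s).
Qed.

(** * Computing interpretations and addable triples from the code of the state *)

Section StateComputability.
Variables (o : nat) (alpha : o.-tuple (state -> nat)).
Notation computable := (computable alpha).
Notation decidable_in := (decidable_in alpha).

Lemma computable_code_head n a :
  computable n a -> computable n (fun s v => code_head (a s v)).
Proof.
apply: computable_fun1; rewrite /code_head.
have := computable_find_below (decidable_odd (computable_iter_half
  (computable_nth alpha 2 0) (computable_nth _ 2 1))) (computable_nth _ 1 0).
exact: computable_ext.
Qed.

Lemma computable_code_nth n i a :
  computable n a -> computable n (fun s v => code_nth i (a s v)).
Proof.
move=> ha; apply: computable_code_head; elim: i => //= i IH.
(* [code_tail] amounts to one halving more than [code_head] counts. *)
have := computable_iter_half (computable_succ (computable_code_head IH)) IH.
exact: computable_ext.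
Qed.

Section Symbol.
Variables (k : nat) (P : primrec k.+1) (n : nat).
Variable g : 'I_k -> state -> seq nat -> nat.
Hypothesis hg : forall i, computable n (g i).

Lemma computable_triple_code b : computable n b ->
  computable n (fun s v => triple_code (inst P [tuple g i s v | i < k], b s v)).
Proof.
move=> hb.
(* One index type covers all entries: [None] is the number of the symbol, [Some (Some i)] an
   argument and [Some None] the value. *)
pose h (j : option (option 'I_k)) := match j with
  | Some (Some i) => g i
  | Some None => b
  | None => fun _ _ => choice.pickle P
  end.
have hh j : computable n (h j).
  by case: j => [[i|]|]; [exact: hg | exact: hb | exact: computable_const].
have := computable_seq_code
  (None :: rcons [seq Some (Some i) | i <- enum 'I_k] (Some None)) hh.
apply: computable_ext => s v.
by rewrite /triple_code /= map_rcons -map_comp.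
Qed.

Lemma decidable_mem b : computable n b ->
  decidable_in n (fun s v => (inst P [tuple g i s v | i < k], b s v) \in val s).
Proof.
move=> hb; have := decidable_odd (computable_iter_half
  (computable_triple_code hb) (computable_code _ n)).
by apply: decidable_ext => s v; rewrite mem_state.
Qed.

End Symbol.

Section ChiPhi.
Variables (k : nat) (P : primrec k.+1) (n : nat).
Variable g : 'I_k -> state -> seq nat -> nat.
Hypothesis hg : forall i, computable n (g i).

Lemma computable_search :
  computable n (fun s v => search P [tuple g i s v | i < k] s).
Proof.
(* The candidate value is the new first entry, which the arguments skip. *)
exact: computable_find_below (decidable_mem P
  (fun i => computable_behead (hg i)) (computable_nth _ n.+1 0))
  (computable_code _ n).
Qed.

Lemma decidable_chi :
  decidable_in n (fun s v => chi P [tuple g i s v | i < k] s).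
Proof.
apply: decidable_ext (decidable_mem P hg computable_search) => s v.
by rewrite chi_search.
Qed.

Lemma computable_phi :
  computable n (fun s v => phi P [tuple g i s v | i < k] s).
Proof.
apply: computable_ext (computable_if decidable_chi computable_search
  (computable_zero _ n)) => s v.
by rewrite phi_search.
Qed.

End ChiPhi.

Section Interp.
Variables (n : nat) (xi : env).
Hypothesis hxi : forall y, computable n (fun s _ => xi y s).

Lemma computable_tinterp t : computable n (fun s _ => tinterp xi t s).
Proof.
elim/term_rect_ffun: t => [x||t IH|k f ts IH|k P ts IH] /=.
- exact: hxi.
- exact: computable_zero.
- exact: computable_succ.
- exact: (computable_peval f IH).
- exact: (computable_phi P IH).
Qed.

Lemma decidable_interp A : decidable_in n (fun s _ => interp xi A s).
Proof.
elim: A => [k Q ts|k P ts|A IH|A IHA B IHB|A IHA B IHB|A IHA B IHB] /=.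
- exact: (decidable_holds Q (fun i => computable_tinterp (ts i))).
- exact: (decidable_chi P (fun i => computable_tinterp (ts i))).
- exact: decidable_neg.
- exact: decidable_and.
- exact: decidable_or.
- apply: decidable_ext (decidable_or (decidable_neg IHA) IHB) => s v.
  by rewrite implybE.
Qed.

End Interp.

Lemma decidable_new_code k (P : primrec k.+1) n a : computable n a ->
  decidable_in n (fun s v => new_code P s (a s v)).
Proof.
move=> ha.
have hd i : computable n (fun s v => code_nth i (a s v)).
  exact: computable_code_nth.
apply: decidable_and.
  by apply: decidable_eq ha _; exact: computable_triple_code.
apply: decidable_and; last by apply: decidable_neg; exact: decidable_chi.
(* The arguments followed by the value are the decoded entries 1 to [k.+1]. *)
apply: decidable_ext (decidable_holds P (fun i : 'I_k.+1 => hd i.+1)) => s v.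
congr (holds P _); apply: val_inj.
by rewrite /= enum_ordSr map_rcons -map_comp.
Qed.

Lemma decidable_new_among Ps n a : computable n a ->
  decidable_in n (fun s v => new_among Ps s (a s v)).
Proof.
move=> ha; elim: Ps => [|P Ps IH]; first exact: computable_zero.
exact: decidable_or (decidable_new_code _ ha) IH.
Qed.

End StateComputability.

(** * The realizer of a predicate that is eventually true on saturated sequences *)

(** No triple of [s] has the same instance as the new one; this gives both its newness and the
    compatibility. *)
Lemma singleton_new Ps (s : state) y : new_among Ps s y ->
  exists (t : state) u, [/\ state_code t = 2 ^ y, val t = [fset u],
    u \notin val s & compatible t s].
Proof.
case/hasP=> Q _ /new_codeP[m [n [-> hP nchi]]].
set u := (inst (tagged Q) m, n).
have new_u v : v \in val s -> v.1 != u.1.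
  move=> h; apply: contra nchi => e; apply/hasP; by exists v.
have st : is_state [fset u].
  apply/andP; split; first by apply/allP => v; rewrite inE => /eqP ->.
  by apply/allrelP => v w; rewrite !inE => /eqP -> /eqP ->; rewrite !eqxx.
exists (exist _ [fset u] st), u; split => //.
- by rewrite /state_code /= big_seq_fset1.
- by apply/negP => /new_u /eqP.
- have [/allP ts /allrelP fs] := andP (valP s).
  apply/andP; split.
    by apply/allP => v; rewrite !inE => /orP[/eqP ->|/ts].
  apply/allrelP => v w; rewrite !inE => /orP[/eqP ->|hv] /orP[/eqP ->|hw].
  + by rewrite !eqxx.
  + by rewrite eq_sym (negbTE (new_u _ hw)).
  + by rewrite (negbTE (new_u _ hv)).
  + exact: fs.
Qed.

Section Realizer.
Variables (Ps : seq {k : nat & primrec k.+1}) (B : state -> bool).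
Hypothesis B_converges : forall sigma, weakly_increasing sigma ->
  converges (fun i => B (sigma i)).
Hypothesis B_saturated : forall sigma, weakly_increasing sigma ->
  saturated Ps sigma -> eventually (fun i => B (sigma i)).

(** If the constant sequence at [s] is saturated then [B s] holds; otherwise some triple can be
    added at [s]. The disjunct [B s] makes the search for [y] total. *)
Lemma new_exists s : exists y, B s || new_among Ps s y.
Proof.
have [Bs|nB] := boolP (B s); first by exists 0.
have wi : weakly_increasing (fun=> s) by move=> i j _; exact: fsubset_refl.
have [|y h] := not_saturated_new (Ps := Ps) wi; last by exists y; exact: (h 0).
by move=> /(B_saturated wi)[N /(_ N (leqnn N))]; rewrite (negbTE nB).
Qed.

Definition least_new s : nat := ex_minn (new_exists s).

(** The code serves recursiveness, the next two properties the definition of interactive realizers,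
    and the last one realization: a triple outside [s] keeps [s] from being a prefix point. *)
Lemma realizer_exists s : exists t : state, [/\
  state_code t = if B s then 0 else 2 ^ least_new s,
  compatible t s, val t `&` val s = fset0 &
  state_le t s -> B s].
Proof.
rewrite /least_new; case: ex_minnP => y; case: ifP => [_ _ _|_ /= hy _].
  have st : is_state fset0 by apply/andP; split; [apply/allP | apply/allrelP].
  exists (exist _ fset0 st); split => //.
  - by rewrite /state_code big_seq_fset0.
  - by rewrite /compatible fset0U; exact: valP.
  - exact: fset0I.
have [t [u [tc tE uns comp]]] := singleton_new hy; exists t; split => //.
- apply/fsetP => v; rewrite tE !inE; apply/negbTE/negP => /andP[/eqP ->].
  exact/negP.
- by rewrite /state_le tE fsub1set (negbTE uns).
Qed.

Definition realizer s : state :=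
  proj1_sig (constructive_indefinite_description _ (realizer_exists s)).

Lemma realizerP s : [/\
  state_code (realizer s) = if B s then 0 else 2 ^ least_new s,
  compatible (realizer s) s, val (realizer s) `&` val s = fset0 &
  state_le (realizer s) s -> B s].
Proof. by rewrite /realizer; case: constructive_indefinite_description. Qed.

(** The limit is the least code [y] addable at every stage. Each smaller code ceases to be addable
    at some stage, for good since states grow, and finitely many such stages have a maximum. *)
Lemma least_new_converges sigma : weakly_increasing sigma ->
  eventually (fun i => ~~ B (sigma i)) ->
  converges (fun i => least_new (sigma i)).
Proof.
move=> wi nB.
have ex : exists y, forall i, new_among Ps (sigma i) y.
  apply: not_saturated_new => // /(B_saturated wi).
  move=> h; apply: eventually_false; apply: eventually_mono2 nB h => i.
  by move/negP.
have [y hy ymin] : exists2 y, (forall i, new_among Ps (sigma i) y) &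
    forall j, j < y -> ~ forall i, new_among Ps (sigma i) j.
  case: ex => y; elim/ltn_ind: y => y IH hy.
  have [[j [lt_jy hj]]|h] :=
    classic (exists j, j < y /\ forall i, new_among Ps (sigma i) j).
    exact: IH hj.
  by exists y => // j lt_jy hj; apply: h; exists j.
have lt_y :
    eventually (fun i => forall j, j < y -> ~~ new_among Ps (sigma i) j).
  apply: eventually_ltn => j /ymin /not_all_ex_not[N hN].
  exists N => i le_Ni; apply: contra_notN hN; exact/new_among_anti/wi.
exists y; apply: eventually_mono2 nB lt_y => i nBi h.
rewrite /least_new; case: ex_minnP => z; rewrite (negbTE nBi) /= => hz zmin.
apply/eqP; rewrite eqn_leq zmin ?hy ?orbT //= leqNgt.
by apply: contraL hz; exact: h.
Qed.

Lemma realizer_interactive : interactive_realizer realizer.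
Proof.
split=> [sigma wi|s|s]; try by case: (realizerP s).
(* Codes determine states, so it is enough that the codes stabilize; the limit of [B] then separates
   the two cases. *)
suff [c [N hN]] : converges (fun i => state_code (realizer (sigma i))).
  by exists N => i le_Ni; apply: state_code_inj; rewrite !hN.
have [[] hB] := B_converges wi.
  exists 0; apply: eventually_mono hB => i e.
  by case: (realizerP (sigma i)); rewrite e.
have nB : eventually (fun i => ~~ B (sigma i)).
  by apply: eventually_mono hB => i ->.
have [y hy] := least_new_converges wi nB; exists (2 ^ y).
apply: eventually_mono2 hB hy => i e <-.
by case: (realizerP (sigma i)); rewrite e.
Qed.

(** [least_new] is found by one unbounded minimization, which halts by [new_exists]. *)
Lemma realizer_recursive o (alpha : o.-tuple (state -> nat)) :
  decidable_in alpha 0 (fun s _ => B s) -> recursive_in alpha realizer.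
Proof.
move=> hB.
have hmin : computable alpha 0 (fun s _ => least_new s).
  apply: (computable_min (decidable_neg (decidable_or (computable_behead hB)
    (decidable_new_among Ps (computable_nth alpha 1 0))))) => s v.
    by rewrite /least_new /=; case: ex_minnP => y ->.
  move=> m; rewrite /least_new /=; case: ex_minnP => y _ ymin.
  by case: (_ || _) (ymin m) => //; rewrite ltnNge => -> .
have [c hc] := computable_if hB (computable_zero alpha 0)
  (computable_exp2 hmin).
exists c => s; have := hc s [tuple]; case: (realizerP s) => <- _ _ _.
by congr (computes _ _ _ _); apply: val_inj.
Qed.

End Realizer.

(** * Individuals as environments and oracles; the conclusion *)

(** Finitely many individuals converge together, so the environment that moves with the state is
    eventually the fixed one made of their limits, as in [eventually_valid]. *)
Lemma env_at_converges k (x : k.-tuple nat) (alpha : k.-tuple (state -> nat))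
    sigma :
  (forall i, strongly_convergent (tnth alpha i)) -> weakly_increasing sigma ->
  exists rho : nat -> nat,
    eventually (fun i => forall y s, env_at x alpha (sigma i) y s = rho y).
Proof.
move=> conv wi.
have [v hv] : converges (fun i => [tuple tnth alpha j (sigma i) | j < k]).
  apply: converges_mktuple => j; have [N hN] := conv j sigma wi.
  by exists (tnth alpha j (sigma N)), N.
exists (fun y => nth 0 v (index y x)); apply: eventually_mono hv => i <- y s.
by rewrite /env_at -[in LHS](map_tnth_enum alpha) -map_comp.
Qed.

(** A variable in [x] takes one oracle query at the current state; any other has the default value
    0. *)
Lemma computable_env_at k (x : k.-tuple nat) (alpha : k.-tuple (state -> nat))
    n y :
  computable alpha n (fun s _ => env_at x alpha s y s).
Proof.
have [lt_y|le_y] := ltnP (index y x) k.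
  apply: computable_ext (computable_oracle alpha n (Ordinal lt_y)) => s v.
  by rewrite /env_at (nth_map (fun=> 0)) ?size_tuple // (tnth_nth (fun=> 0)).
apply: computable_ext (computable_zero alpha n) => s _.
by rewrite /env_at nth_default // size_map size_tuple.
Qed.

Theorem theorem6p17 (k : nat) (x : k.-tuple nat) (A : formula) :
  uniq x -> {subset fv A <= x} -> PRA_EM1 A ->
  forall alpha : k.-tuple (state -> nat),
    (forall i, strongly_convergent (tnth alpha i)) ->
    exists r : state -> state,
      [/\ interactive_realizer r, recursive_in alpha r &
          realizes r x alpha A].
Proof.
move=> _ _ derA alpha conv.
have [Ps validA] := derives_eventually_valid derA (fun _ => id).
pose B s := interp (env_at x alpha s) A s.
have B_converges sigma : weakly_increasing sigma ->
    converges (fun i => B (sigma i)).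
  move=> wi; have [rho hrho] := env_at_converges x conv wi.
  have [b hb] := interp_converges wi rho A; exists b.
  apply: eventually_mono2 hrho hb => i e <-.
  by apply: interp_ext => y; exact: e.
have B_saturated sigma : weakly_increasing sigma -> saturated Ps sigma ->
    eventually (fun i => B (sigma i)).
  move=> wi sat; have [rho hrho] := env_at_converges x conv wi.
  apply: eventually_mono2 hrho (validA sigma wi sat rho) => i e.
  by congr is_true; apply/esym/interp_ext => y; exact: e.
exists (realizer B_saturated); split.
- exact: realizer_interactive.
- apply: realizer_recursive.
  (* The environment frozen at [s] and the one that follows the state agree at [s], where the
     formula is evaluated. *)
  apply: decidable_ext (@decidable_interp _ alpha 0
    (fun y s => env_at x alpha s y s) (computable_env_at x alpha 0) A) => s v.
  exact: interp_ext.
- by move=> s; case: (realizerP B_saturated s).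
Qed.
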